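(* For any $n>0$, the map $\Theta:\mathbf{M}_n\to\mathbf{A}_n^{\mathrm{reg}}$ defined by linear extension of $\Theta: f(\chi_1)\cdots f(\chi_n)\,u_0\mapsto \mathbf{m}(\chi)$, $\chi\in\mathbb{Z}^n$, is an isomorphism of $\mathbb{Z}$-graded $\mathbf{A}_n$-modules.
   Context: Let $\mathbb{k}$ be a field of characteristic zero. Let $\mathrm{sl}(2)$ be the Lie algebra over $\mathbb{k}$ with basis $e,f,h$ and $[e,f]=h$, $[h,e]=2e$, $[h,f]=-2f$. Let $\mathfrak{g}=\mathrm{sl}(2)\otimes\mathbb{k}[t^{\pm1}]$ be the loop algebra, with $x(k)=x\otimes t^k$ and $[x(k),y(l)]=[x,y](k+l)$. Put $\mathcal{E}=\bigoplus_{j\in\mathbb{Z}}\mathbb{k}e(j)$, $\mathcal{H}=\bigoplus_{j\in\mathbb{Z}}\mathbb{k}h(j)$, $\mathcal{F}=\bigoplus_{j\in\mathbb{Z}}\mathbb{k}f(j)$. Let $\mathbf{M}(0)=\mathrm{Ind}_{\mathcal{H}\oplus\mathcal{E}}^{\mathfrak{g}}\,\mathbb{k}u_0$ be the $\mathfrak{g}$-module induced from the one-dimensional module $\mathbb{k}u_0$ with $(\mathcal{H}\oplus\mathcal{E})\cdot u_0=0$. For $n\geq 0$, $\mathbf{M}_n=\{v\in\mathbf{M}(0): h(0)v=-2nv\}$ is the $n$-th layer; it is spanned by the elements $f(\chi_1)\cdots f(\chi_n)u_0$, $\chi\in\mathbb{Z}^n$, and is $\mathbb{Z}$-graded by $\deg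 f(\chi_1)\cdots f(\chi_n)u_0=\sum_i\chi_i$. For $n>0$, $\mathbf{A}_n=\mathbb{k}[z_1^{\pm1},\dots,z_n^{\pm1}]^{\mathrm{Sym}(n)}$ is the algebra of symmetric Laurent polynomials, $\mathbb{Z}$-graded by total degree, and $\mathbf{m}(\gamma)=\frac1{n!}\sum_{\sigma\in\mathrm{Sym}(n)}\prod_{i=1}^n z_{\sigma(i)}^{\gamma_i}$ for $\gamma\in\mathbb{Z}^n$ (these span $\mathbf{A}_n$). The layer $\mathbf{M}_n$ is regarded as a graded $\mathbf{A}_n$-module via linear extension of $\mathbf{m}(\gamma)\cdot f(\chi_1)\cdots f(\chi_n)u_0=\frac1{n!}\sum_{\sigma\in\mathrm{Sym}(n)}\prod_{i=1}^n f(\chi_i+\gamma_{\sigma(i)})\,u_0$, $\gamma,\chi\in\mathbb{Z}^n$. $\mathbf{A}_n^{\mathrm{reg}}$ denotes $\mathbf{A}_n$ considered as a $\mathbb{Z}$-graded $\mathbf{A}_n$-module under multiplication. *)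

(* Defs.v *)
From HB Require Import structures.
From mathcomp Require Import all_boot all_order all_algebra all_fingroup.
From mathcomp Require Import ring_quotient.
From mathcomp Require Import finmap.
From mathcomp Require Import monalg.
From mathcomp Require boolp.

Set Implicit Arguments.
Unset Strict Implicit.
Unset Printing Implicit Defensive.

Import GRing.Theory.

Local Open Scope ring_scope.

(* {malg k[K]} serves below as the free k-module on the set K, with <<a>> the
   basis vector attached to a : K; linext h is the linear extension of h. *)
Section LinearExtension.
Context (k : fieldType) (K : choiceType).

Definition linext (V : lmodType k) (h : K -> V) (g : {malg k[K]}) : V :=
  \sum_(a <- msupp g) g@_a *: h a.

Context (V : lmodType k) (h : K -> V).

Lemma linextw (d : {fset K}) g : (msupp g `<=` d)%fset ->
  linext h g = \sum_(a <- d) g@_a *: h a.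
Proof.
move=> le; rewrite /linext (big_fset_incl _ le) // => a _ /mcoeff_outdom ->.
by rewrite scale0r.
Qed.

Lemma linext_is_linear : linear (linext h).
Proof.
move=> c g1 g2; pose d := (msupp g1 `|` msupp g2 `|` msupp (c *: g1 + g2))%fset.
rewrite (@linextw d) ?fsubsetUr// (@linextw d g1); last first.
  by rewrite /d -fsetUA fsubsetUl.
rewrite (@linextw d g2); last by rewrite /d (fsetUC (msupp g1)) -fsetUA fsubsetUl.
rewrite scaler_sumr -big_split; apply: eq_bigr => a _ /=.
by rewrite mcoeffD mcoeffZ scalerDl scalerA.
Qed.
HB.instance Definition _ := GRing.isLinear.Build k {malg k[K]} V _ (linext h)
  linext_is_linear.

Lemma linextU a : linext h << a >> = h a.
Proof. by rewrite /linext msuppU oner_eq0 big_seq_fset1 mcoeffUU scale1r. Qed.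

Lemma malg_lind (P : {malg k[K]} -> Prop) :
  (forall c g1 g2, P g1 -> P g2 -> P (c *: g1 + g2)) -> P 0 ->
  (forall a, P << a >>) -> forall g, P g.
Proof.
move=> PD P0 PU g; rewrite [g]monalgE; elim/big_rec: _ => // a x _ Px.
suff -> : << g@_a *g a >> = g@_a *: << a >> :> {malg k[K]} by apply: PD.
by apply/malgP => b; rewrite mcoeffZ !mcoeffU mulr_natr.
Qed.

Lemma linext_fun (f : K -> V) c g :
  linext (fun a => c *: f a + h a) g = c *: linext f g + linext h g.
Proof.
rewrite /linext scaler_sumr -big_split; apply: eq_bigr => a _ /=.
by rewrite scalerDr !scalerA [c * _]mulrC.
Qed.

Lemma eq_linext (f : K -> V) g : f =1 h -> linext f g = linext h g.
Proof. by move=> fh; apply: eq_bigr => a _; rewrite fh. Qed.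

End LinearExtension.

Lemma malg_scaleAr (k : fieldType) (K : monomType) (c : k) (s t : {malg k[K]}) :
  s * (c *: t) = c *: (s * t).
Proof.
have E : s * c%:MP = c *: s.
  rewrite -mul_malgC !malgM_def fgmulUg fgmulgU; apply: eq_bigr => a _.
  by rewrite mulm1 mul1m mulrC.
by rewrite -mul_malgC mulrA E scalerAl.
Qed.

Lemma linear_fun0 (k : fieldType) (V W : lmodType k) (f : V -> W) :
  linear f -> f 0 = 0.
Proof.
by move=> fL; have := fL (-1) 0 0; rewrite !(scaleN1r, subrr, addNr).
Qed.

Lemma linear_funZ (k : fieldType) (V W : lmodType k) (f : V -> W) :
  linear f -> forall c v, f (c *: v) = c *: f v.
Proof.
by move=> fL c v; have := fL c v 0; rewrite (linear_fun0 fL) !addr0.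
Qed.

Section Laurent.
Context (k : fieldType) (n : nat).

(* k[z_1^{+-1}, ..., z_n^{+-1}], as the group algebra of Z^n: the basis vector
   attached to chi is the monomial prod_i z_i^(chi i). *)
Definition expo := {ffun 'I_n -> int}.
Definition laurent : Type := {malg k[expo]}.
HB.instance Definition _ := GRing.Lmodule.on laurent.

Implicit Types (p q r : laurent) (chi gamma : expo) (s : 'S_n).

Definition mono chi : laurent := << chi >>.

Lemma laurent_ind (P : laurent -> Prop) :
  (forall c p q, P p -> P q -> P (c *: p + q)) -> P 0 ->
  (forall chi, P (mono chi)) -> forall p, P p.
Proof. exact: malg_lind. Qed.

Definition lmul p q : laurent :=
  linext (fun a => linext (fun b => mono (a + b)) q) p.

Lemma lmulUl a q : lmul (mono a) q = linext (fun b => mono (a + b)) q.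
Proof. by rewrite /lmul linextU. Qed.

Lemma lmulUU a b : lmul (mono a) (mono b) = mono (a + b).
Proof. by rewrite lmulUl linextU. Qed.

Lemma lmul_linearl q : linear (lmul^~ q).
Proof. by move=> c p1 p2; rewrite /lmul linearP. Qed.

Lemma lmul_linearr p : linear (lmul p).
Proof.
move=> c q1 q2; rewrite /lmul -linext_fun; apply: eq_linext => a; exact: linearP.
Qed.

Lemma lmul0l q : lmul 0 q = 0. Proof. by rewrite /lmul linear0. Qed.
Lemma lmul0r p : lmul p 0 = 0.
Proof. exact: linear_fun0 (lmul_linearr p). Qed.

Local Opaque lmul mono.

Lemma lmulC : commutative lmul.
Proof.
move=> p q; elim/laurent_ind: p => [c p1 p2 IH1 IH2||a].
- by rewrite lmul_linearl lmul_linearr IH1 IH2.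
- by rewrite lmul0l lmul0r.
elim/laurent_ind: q => [c p1 p2 IH1 IH2||b].
- by rewrite lmul_linearl lmul_linearr IH1 IH2.
- by rewrite lmul0l lmul0r.
by rewrite !lmulUU addrC.
Qed.

Lemma lmulA : associative lmul.
Proof.
move=> p q r; elim/laurent_ind: p => [c p1 p2 IH1 IH2||a].
- by rewrite !(lmul_linearl _ c) IH1 IH2.
- by rewrite !lmul0l.
elim/laurent_ind: q => [c p1 p2 IH1 IH2||b].
- rewrite (lmul_linearl r c p1 p2) (lmul_linearr (mono a) c p1 p2).
  rewrite (lmul_linearr (mono a) c (lmul p1 r) (lmul p2 r)) IH1 IH2.
  by rewrite (lmul_linearl r c (lmul (mono a) p1) (lmul (mono a) p2)).
- by rewrite lmul0l lmul0r lmul0l.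
elim/laurent_ind: r => [c p1 p2 IH1 IH2||d].
- rewrite (lmul_linearr (mono b) c p1 p2).
  rewrite (lmul_linearr (mono a) c (lmul (mono b) p1) (lmul (mono b) p2)).
  rewrite (lmul_linearr (lmul (mono a) (mono b)) c p1 p2).
  exact: (f_equal2 (fun x y => c *: x + y) IH1 IH2).
- by rewrite !lmul0r.
by rewrite !lmulUU addrA.
Qed.

Lemma lmul1 : left_id (mono 0) lmul.
Proof.
move=> p; elim/laurent_ind: p => [c p1 p2 IH1 IH2||b].
- by rewrite lmul_linearr IH1 IH2.
- by rewrite lmul0r.
by rewrite lmulUU add0r.
Qed.

Lemma lmulDl : left_distributive lmul +%R.
Proof. by move=> p q r; have := lmul_linearl r 1 p q; rewrite !scale1r. Qed.

Local Transparent lmul mono.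

Lemma mono0_neq0 : mono 0 != 0.
Proof. by rewrite /mono monalgU_eq0 oner_eq0. Qed.

HB.instance Definition _ :=
  GRing.Zmodule_isComNzRing.Build laurent lmulA lmulC lmul1 lmulDl mono0_neq0.

Lemma lscaleAl (c : k) p q : c *: (p * q) = (c *: p) * q.
Proof. by have := lmul_linearl q c p 0; rewrite !addr0 lmul0l addr0. Qed.

HB.instance Definition _ := GRing.Lmodule_isLalgebra.Build k laurent lscaleAl.
HB.instance Definition _ := GRing.Lalgebra_isComAlgebra.Build k laurent.

Lemma monoM a b : mono a * mono b = mono (a + b). Proof. exact: lmulUU. Qed.
Lemma mono0 : mono 0 = 1. Proof. by []. Qed.

(* z_j^a *)
Definition zpow (j : 'I_n) (a : int) : laurent :=
  mono [ffun i => if i == j then a else 0].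

(* The algebra automorphism z_i |-> z_(s i). *)
Definition lperm s : laurent -> laurent :=
  linext (fun chi => mono [ffun j => chi ((s^-1)%g j)]).
HB.instance Definition _ s := GRing.Linear.on (lperm s).

Lemma lpermU s chi : lperm s (mono chi) = mono [ffun j => chi ((s^-1)%g j)].
Proof. by rewrite /lperm linextU. Qed.

Lemma lperm_monoid s : monoid_morphism (lperm s).
Proof.
split=> [|p q].
  by rewrite -mono0 lpermU; congr mono; apply/ffunP=> j; rewrite !ffunE.
elim/laurent_ind: p => [c p1 p2 IH1 IH2||a].
- by rewrite mulrDl -scalerAl !linearP /= IH1 IH2 mulrDl -scalerAl.
- by rewrite mul0r (linear0 (lperm s)) mul0r.
elim/laurent_ind: q => [c p1 p2 IH1 IH2||b].
- rewrite (mulrDr (mono a) (c *: p1)) -(scalerAr c (mono a) p1).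
  rewrite (linearP (lperm s) c p1 p2) (linearP (lperm s) c (mono a * p1)).
  rewrite mulrDr -(scalerAr c (lperm s (mono a))).
  exact: (f_equal2 (fun x y => c *: x + y) IH1 IH2).
- by rewrite (mulr0 (mono a)) (linear0 (lperm s)) (mulr0 (lperm s (mono a))).
rewrite monoM !lpermU monoM.
by congr mono; apply/ffunP=> j; rewrite !ffunE.
Qed.
HB.instance Definition _ s :=
  GRing.isMonoidMorphism.Build laurent laurent (lperm s) (lperm_monoid s).

Lemma lperm_zpow s j a : lperm s (zpow j a) = zpow (s j) a.
Proof.
rewrite /zpow lpermU; congr mono; apply/ffunP=> i; rewrite !ffunE.
by rewrite -(inj_eq (@perm_inj _ s)) permKV.
Qed.

Definition symmetric_laurent : {pred laurent} :=
  fun p => [forall s : 'S_n, lperm s p == p].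

Lemma symmetricP p :
  reflect (forall s, lperm s p = p) (p \in symmetric_laurent).
Proof. exact: 'forall_eqP. Qed.

Lemma symmetric_subring : subring_closed symmetric_laurent.
Proof.
split=> [|p q /symmetricP Sp /symmetricP Sq|p q /symmetricP Sp /symmetricP Sq];
apply/symmetricP=> s.
- exact: rmorph1.
- by rewrite raddfB /= Sp Sq.
- by rewrite rmorphM /= Sp Sq.
Qed.

Lemma symmetric_scaler : GRing.scaler_closed symmetric_laurent.
Proof.
by move=> c p /symmetricP Sp; apply/symmetricP=> s; rewrite linearZ /= Sp.
Qed.

HB.instance Definition _ :=
  GRing.isSubringClosed.Build laurent symmetric_laurent symmetric_subring.
HB.instance Definition _ :=
  GRing.isScaleClosed.Build k laurent symmetric_laurent symmetric_scaler.

Record sym_laurent :=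
  SymLaurent { laurent_of : laurent; _ : laurent_of \in symmetric_laurent }.
HB.instance Definition _ := [isSub for laurent_of].
HB.instance Definition _ := [Choice of sym_laurent by <:].
HB.instance Definition _ := [SubChoice_isSubComNzRing of sym_laurent by <:].
HB.instance Definition _ := [SubZmodule_isSubLmodule of sym_laurent by <:].
HB.instance Definition _ :=
  [SubNzRing_SubLmodule_isSubLalgebra of sym_laurent by <:].
HB.instance Definition _ := GRing.Lalgebra_isComAlgebra.Build k sym_laurent.

Definition msym_laurent gamma : laurent :=
  (n`!%:R)^-1 *: \sum_(s : 'S_n) \prod_(i < n) zpow (s i) (gamma i).

Lemma msym_symmetric gamma : msym_laurent gamma \in symmetric_laurent.
Proof.
apply: rpredZ; apply/symmetricP=> t; rewrite (raddf_sum (lperm t)) /=.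
rewrite (reindex_inj (mulIg (t^-1)%g)) /=; apply: eq_bigr => s _.
rewrite (rmorph_prod (lperm t)); apply: eq_bigr => i _.
have E : lperm t (zpow ((s * t^-1)%g i) (gamma i)) = zpow (s i) (gamma i).
  by rewrite lperm_zpow permM permKV.
exact: E.
Qed.

Definition msym gamma : sym_laurent := SymLaurent (msym_symmetric gamma).

Definition expo_deg chi : int := \sum_(i < n) chi i.

Definition sym_laurent_deg (d : int) (p : sym_laurent) : Prop :=
  forall chi, chi \in msupp (laurent_of p) -> expo_deg chi = d.

End Laurent.

Variant sl2_basis := sl2_e | sl2_f | sl2_h.

Definition sl2_basis_code (x : sl2_basis) : 'I_3 :=
  match x with sl2_e => inord 0 | sl2_f => inord 1 | sl2_h => inord 2 end.
Definition sl2_basis_decode (i : 'I_3) : sl2_basis :=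
  match val i with 0 => sl2_e | 1 => sl2_f | _ => sl2_h end.
Lemma sl2_basis_codeK : cancel sl2_basis_code sl2_basis_decode.
Proof. by case; rewrite /sl2_basis_decode /= inordK. Qed.
HB.instance Definition _ := Countable.copy sl2_basis (can_type sl2_basis_codeK).

Section Loop.
Context (k : fieldType).

Definition sl2_bracket (x y : sl2_basis) : {malg k[sl2_basis]} :=
  match x, y with
  | sl2_e, sl2_f => << sl2_h >>
  | sl2_f, sl2_e => - << sl2_h >>
  | sl2_h, sl2_e => 2%:R *: << sl2_e >>
  | sl2_e, sl2_h => - (2%:R *: << sl2_e >>)
  | sl2_h, sl2_f => - (2%:R *: << sl2_f >>)
  | sl2_f, sl2_h => 2%:R *: << sl2_f >>
  | _, _ => 0
  end.

(* sl(2) (x) k[t^{+-1}], with k-basis the x (x) t^j, x in {e, f, h}, j in Z. *)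
Definition loop : Type := {malg k[(sl2_basis * int)%type]}.
HB.instance Definition _ := GRing.Lmodule.on loop.

(* x (x) t^j for x in sl(2) *)
Definition at_pow (x : {malg k[sl2_basis]}) (j : int) : loop :=
  linext (fun a => << (a, j) >> : loop) x.

Definition loop_e (j : int) : loop := at_pow << sl2_e >> j.
Definition loop_f (j : int) : loop := at_pow << sl2_f >> j.
Definition loop_h (j : int) : loop := at_pow << sl2_h >> j.

Definition loop_bracket (x y : loop) : loop :=
  linext (fun a =>
    linext (fun b => at_pow (sl2_bracket a.1 b.1) (a.2 + b.2)) y) x.

Lemma at_powU a j : at_pow << a >> j = << (a, j) >>.
Proof. exact: linextU. Qed.

Lemma at_pow_linear j : linear (at_pow^~ j).
Proof. move=> c x y; exact: linearP. Qed.

Lemma loop_bracketU a b :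
  loop_bracket << a >> << b >> = at_pow (sl2_bracket a.1 b.1) (a.2 + b.2).
Proof. by rewrite /loop_bracket linextU linextU. Qed.

(* the subalgebra H (+) E *)
Definition borel (x : loop) : Prop :=
  forall a, a \in msupp x -> a.1 <> sl2_f.

Record lie_module (V : lmodType k) (act : loop -> V -> V) : Prop := {
  lie_linearl : forall v, linear (act^~ v);
  lie_linearr : forall x, linear (act x);
  lie_bracket : forall x y v,
    act (loop_bracket x y) v = act x (act y v) - act y (act x v)
}.

(* The tensor algebra of the loop algebra. *)
Definition tensor : Type := {malg k[{fmonom (sl2_basis * int)%type}]}.
HB.instance Definition _ := GRing.Lalgebra.on tensor.

Definition to_tensor : loop -> tensor :=
  linext (fun a => << fmu a >> : tensor).
HB.instance Definition _ := GRing.Linear.on to_tensor.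

(* I + T.(H (+) E), where T is the tensor algebra and I the two-sided ideal
   with T / I = U(g).  The quotient of T by it is U(g) / U(g).(H (+) E), that
   is, U(g) (x)_{U(H (+) E)} k with k the trivial module. *)
Inductive M0_rel : tensor -> Prop :=
| M0_rel0 : M0_rel 0
| M0_relD s t : M0_rel s -> M0_rel t -> M0_rel (s + t)
| M0_rel_lie s t x y :
    M0_rel (s * (to_tensor x * to_tensor y - to_tensor y * to_tensor x
                 - to_tensor (loop_bracket x y)) * t)
| M0_rel_borel s x : borel x -> M0_rel (s * to_tensor x).

Lemma M0_relM a t : M0_rel t -> M0_rel (a * t).
Proof.
elim=> {t} [|s t _ IHs _ IHt|s t x y|s x bx].
- by rewrite mulr0; apply: M0_rel0.
- by rewrite mulrDr; apply: M0_relD.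
- by rewrite mulrA [a * _]mulrA; apply: M0_rel_lie.
- by rewrite mulrA; apply: M0_rel_borel.
Qed.

Definition M0_relb : {pred tensor} := fun t => boolp.asbool (M0_rel t).

Lemma M0_relbP t : reflect (M0_rel t) (t \in M0_relb).
Proof. exact: boolp.asboolP. Qed.

Lemma M0_rel_zmod : zmod_closed M0_relb.
Proof.
split=> [|s t /M0_relbP Js /M0_relbP Jt]; apply/M0_relbP; first exact: M0_rel0.
by apply: M0_relD => //; rewrite -mulN1r; apply: M0_relM.
Qed.
HB.instance Definition _ :=
  GRing.isZmodClosed.Build tensor M0_relb M0_rel_zmod.

Definition M0 : Type := Quotient.quot M0_relb.
HB.instance Definition _ := GRing.Zmodule.on M0.

Definition M0_pi (t : tensor) : M0 := (\pi_(Quotient.quot M0_relb) t)%qT.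
Definition M0_repr (v : M0) : tensor := generic_quotient.repr v.

Lemma M0_reprK v : M0_pi (M0_repr v) = v.
Proof. exact: generic_quotient.reprK. Qed.

Lemma M0_piB s t : M0_pi (s - t) = M0_pi s - M0_pi t.
Proof. by rewrite /M0_pi raddfB. Qed.
Lemma M0_piD s t : M0_pi (s + t) = M0_pi s + M0_pi t.
Proof. by rewrite /M0_pi raddfD. Qed.

Lemma M0_pi0 : M0_pi 0 = 0.
Proof. by rewrite /M0_pi raddf0. Qed.

Lemma M0_pi_eq s t : (M0_pi s = M0_pi t) <-> M0_rel (s - t).
Proof.
split=> [/eqP|] H.
  by apply/M0_relbP; rewrite Quotient.idealrBE.
by apply/eqP; rewrite -[_ == _]Quotient.idealrBE; apply/M0_relbP.
Qed.

Definition M0_tact (t : tensor) (v : M0) : M0 := M0_pi (t * M0_repr v).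

Lemma M0_tact_pi t s : M0_tact t (M0_pi s) = M0_pi (t * s).
Proof.
apply/M0_pi_eq; rewrite -mulrBr; apply: M0_relM.
by apply/M0_pi_eq; rewrite M0_reprK.
Qed.

Lemma M0_tactM s t v : M0_tact (s * t) v = M0_tact s (M0_tact t v).
Proof. by rewrite -[v]M0_reprK !M0_tact_pi mulrA. Qed.
Lemma M0_tact1 v : M0_tact 1 v = v.
Proof. by rewrite -[v]M0_reprK !M0_tact_pi mul1r. Qed.
Lemma M0_tactDl v s t : M0_tact (s + t) v = M0_tact s v + M0_tact t v.
Proof. by rewrite -[v]M0_reprK !M0_tact_pi mulrDl M0_piD. Qed.
Lemma M0_tactBl v s t : M0_tact (s - t) v = M0_tact s v - M0_tact t v.
Proof. by rewrite -[v]M0_reprK !M0_tact_pi mulrBl M0_piB. Qed.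
Lemma M0_tactDr t u v : M0_tact t (u + v) = M0_tact t u + M0_tact t v.
Proof.
by rewrite -[u]M0_reprK -[v]M0_reprK -M0_piD !M0_tact_pi mulrDr M0_piD.
Qed.

Lemma tensor_scale1l (c : k) (t : tensor) : (c *: 1) * t = c *: t.
Proof. by rewrite -[LHS](scalerAl c 1 t) mul1r. Qed.

Definition M0_scale (c : k) (v : M0) : M0 := M0_tact (c *: 1) v.

Lemma M0_scaleA a b v : M0_scale a (M0_scale b v) = M0_scale (a * b) v.
Proof.
apply: etrans (esym (M0_tactM (a *: 1) (b *: 1) v)) _.
have E := etrans (tensor_scale1l a (b *: 1)) (scalerA a b (1 : tensor)).
exact: (congr1 (fun t => M0_tact t v) E).
Qed.
Lemma M0_scale1 : left_id 1 M0_scale.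
Proof. by move=> v; rewrite /M0_scale scale1r M0_tact1. Qed.
Lemma M0_scaleDr : right_distributive M0_scale +%R.
Proof. by move=> c u v; apply: M0_tactDr. Qed.
Lemma M0_scaleDl v : {morph M0_scale^~ v : a b / a + b}.
Proof. by move=> a b; rewrite /M0_scale scalerDl M0_tactDl. Qed.
HB.instance Definition _ := GRing.Zmodule_isLmodule.Build k M0
  M0_scaleA M0_scale1 M0_scaleDr M0_scaleDl.

Lemma M0_piZ c t : M0_pi (c *: t) = c *: M0_pi t.
Proof.
apply: esym; apply: etrans (M0_tact_pi (c *: 1) t) _.
exact: (congr1 M0_pi (tensor_scale1l c t)).
Qed.

Lemma M0_tactZl c t v : M0_tact (c *: t) v = c *: M0_tact t v.
Proof.
apply: esym; apply: etrans (esym (M0_tactM (c *: 1) t v)) _.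
exact: (congr1 (fun s => M0_tact s v) (tensor_scale1l c t)).
Qed.

Lemma tensor_scaleAr c (s t : tensor) : s * (c *: t) = c *: (s * t).
Proof. exact: malg_scaleAr. Qed.

Lemma M0_tactZr c t v : M0_tact t (c *: v) = c *: M0_tact t v.
Proof.
rewrite -[v]M0_reprK -M0_piZ !M0_tact_pi -M0_piZ; congr M0_pi.
exact: tensor_scaleAr.
Qed.

Definition M0_act (x : loop) (v : M0) : M0 := M0_tact (to_tensor x) v.

Definition u0 : M0 := M0_pi 1.

Lemma M0_tact_lie s t b v : M0_tact (s * t - t * s - b) v = 0 ->
  M0_tact b v = M0_tact s (M0_tact t v) - M0_tact t (M0_tact s v).
Proof.
move=> H; apply: etrans (f_equal2 (fun x y => x - y) (M0_tactM s t v)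
  (M0_tactM t s v)).
apply/esym/subr0_eq; apply: etrans H; apply: esym.
apply: etrans (M0_tactBl v (s * t - t * s) b) _.
exact: (congr1 (fun x => x - _) (M0_tactBl v (s * t) (t * s))).
Qed.

Lemma M0_lie_module : lie_module M0_act.
Proof.
split=> [v c x y|x c u v|x y v].
- rewrite -M0_tactZl -M0_tactDl; congr (M0_tact _ v); exact: linearP.
- apply: etrans (M0_tactDr (to_tensor x) (c *: u) v) _.
  exact: (congr1 (+%R^~ _) (M0_tactZr c (to_tensor x) u)).
apply: M0_tact_lie; rewrite -[v]M0_reprK M0_tact_pi.
apply: etrans M0_pi0; apply/M0_pi_eq.
rewrite subr0 -[X in X * _]mul1r; exact: M0_rel_lie.
Qed.

Lemma M0_act_u0 x : borel x -> M0_act x u0 = 0.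
Proof.
move=> bx; rewrite /M0_act M0_tact_pi -M0_pi0; apply/M0_pi_eq.
rewrite subr0 mulr1 -[to_tensor x]mul1r; exact: M0_rel_borel.
Qed.

Lemma malgMU (a b : {fmonom (sl2_basis * int)%type}) :
  (<< a >> * << b >> : tensor) = << mmul a b >>.
Proof. by rewrite [LHS]malgM_def fgmulUU mulr1. Qed.

Section Universal.
Context (N : lmodType k) (rho : loop -> N -> N) (w : N).
Hypotheses (rhoP : lie_module rho) (rho_w : forall x, borel x -> rho x w = 0).

Let word (m : seq (sl2_basis * int)) (v : N) : N :=
  foldr (fun a => rho << a >>) v m.

Let wact (t : tensor) (v : N) : N := linext (fun m => word (fmonom_val m) v) t.

Let rho0 x : rho x 0 = 0.
Proof. exact: linear_fun0 (lie_linearr rhoP x). Qed.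

Let word_linear m : linear (word m).
Proof.
elim: m => [|a m IHm] c u v //=.
apply: etrans (congr1 (rho << a >>) (IHm c u v)) _.
exact: (lie_linearr rhoP).
Qed.

Let wact_linearr t : linear (wact t).
Proof.
move=> c u v; rewrite /wact -linext_fun; apply: eq_linext => m.
exact: word_linear.
Qed.

Let wact_linearl v : linear (wact^~ v).
Proof. move=> c s t; exact: linearP. Qed.

Let wactU m v : wact << m >> v = word (fmonom_val m) v.
Proof. by rewrite /wact linextU. Qed.

Let wact0l v : wact 0 v = 0. Proof. exact: linear0. Qed.

Let wact0r t : wact t 0 = 0.
Proof. exact: linear_fun0 (wact_linearr t). Qed.

Let wactM s t v : wact (s * t) v = wact s (wact t v).
Proof.
elim/malg_lind: s => [c s1 s2 IH1 IH2||a].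
- have -> : ((c *: s1 + s2) * t : tensor) = c *: (s1 * t : tensor) + s2 * t.
    by rewrite mulrDl -(scalerAl c s1 t).
  rewrite (wact_linearl v) (wact_linearl (wact t v) c s1 s2).
  exact: (f_equal2 (fun x y => c *: x + y) IH1 IH2).
- by rewrite mul0r !wact0l.
elim/malg_lind: t => [c t1 t2 IH1 IH2||b].
- have -> : (<< a >> * (c *: t1 + t2) : tensor)
            = c *: (<< a >> * t1 : tensor) + << a >> * t2.
    by rewrite mulrDr (tensor_scaleAr c << a >> t1).
  rewrite (wact_linearl v) (wact_linearl v c t1 t2) (wact_linearr << a >>).
  exact: (f_equal2 (fun x y => c *: x + y) IH1 IH2).
- by rewrite (mulr0 (<< a >> : tensor)) !wact0l wact0r.
by rewrite malgMU !wactU fmM /word foldr_cat.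
Qed.

Let wact_loop x v : wact (to_tensor x) v = rho x v.
Proof.
elim/malg_lind: x => [c x y IH1 IH2||a].
- have -> : to_tensor (c *: x + y) = c *: to_tensor x + to_tensor y.
    exact: linearP.
  rewrite (wact_linearl v) (lie_linearl rhoP v c x y).
  exact: (f_equal2 (fun x y => c *: x + y) IH1 IH2).
- have -> : to_tensor 0 = 0 by exact: linear0.
  by rewrite wact0l; apply/esym; exact: linear_fun0 (lie_linearl rhoP v).
by rewrite /to_tensor linextU wactU fmuE.
Qed.

Let wactB v s t : wact (s - t) v = wact s v - wact t v.
Proof. exact: linearB. Qed.

Let wact_mul x y v : wact (to_tensor x * to_tensor y) v = rho x (rho y v).
Proof. by rewrite wactM !wact_loop. Qed.

Let wact_lie x y v :
  wact (to_tensor x * to_tensor y - to_tensor y * to_tensor x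
        - to_tensor (loop_bracket x y)) v = 0.
Proof.
apply: etrans (wactB v _ (to_tensor (loop_bracket x y))) _.
apply: etrans (f_equal2 (fun a b => a - b) (wactB v _ _) (wact_loop _ v)) _.
apply: etrans (f_equal2 (fun a b => a - b - _) (wact_mul x y v)
  (wact_mul y x v)) _.
by rewrite (lie_bracket rhoP) subrr.
Qed.

Let wact_rel t : M0_rel t -> wact t w = 0.
Proof.
elim=> {t} [|s t _ IHs _ IHt|s t x y|s x bx].
- exact: wact0l.
- have -> : wact (s + t) w = wact s w + wact t w by exact: linearD.
  by rewrite IHs IHt addr0.
- apply: etrans (wactM _ t w) _; apply: etrans (wactM s _ _) _.
  by apply: etrans (congr1 (wact s) (wact_lie x y _)) (wact0r s).
by rewrite wactM wact_loop rho_w // wact0r.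
Qed.

Let Phi (v : M0) : N := wact (M0_repr v) w.

Let Phi_pi t : Phi (M0_pi t) = wact t w.
Proof.
apply/eqP; rewrite -subr_eq0 -wactB; apply/eqP/wact_rel/M0_pi_eq.
exact: M0_reprK.
Qed.

Let Phi_linear : linear Phi.
Proof.
move=> c u v; rewrite -[u]M0_reprK -[v]M0_reprK -M0_piZ -M0_piD !Phi_pi.
exact: wact_linearl.
Qed.

(* M0 is the module induced from the trivial H (+) E-module k.u0: morphisms of
   loop-modules M0 -> N correspond to the vectors of N killed by H (+) E. *)
Lemma M0_universal :
  exists Phi : {linear M0 -> N},
    [/\ Phi u0 = w, forall x v, Phi (M0_act x v) = rho x (Phi v)
      & forall Psi : {linear M0 -> N}, Psi u0 = w ->
          (forall x v, Psi (M0_act x v) = rho x (Psi v)) -> Psi =1 Phi].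
Proof.
pose PhiL := GRing.isLinear.Build k M0 N *:%R Phi Phi_linear.
pose PhiF : {linear M0 -> N} := HB.pack Phi PhiL.
exists PhiF; split=> /=.
- by rewrite Phi_pi wactU fm1.
- move=> x v; rewrite -[v]M0_reprK /M0_act M0_tact_pi !Phi_pi wactM.
  exact: wact_loop.
move=> Psi Psi_u0 Psi_act v; rewrite -[v]M0_reprK Phi_pi.
elim/malg_lind: (M0_repr v) => [c s t IH1 IH2||m].
- rewrite M0_piD M0_piZ linearP (wact_linearl w c s t).
  exact: (f_equal2 (fun x y => c *: x + y) IH1 IH2).
- by rewrite M0_pi0 linear0 wact0l.
rewrite wactU; case: m => m /=; elim: m => [|a m IHm] /=.
  by rewrite -fmoneE.
have -> : << FMonom (a :: m) >> =
          to_tensor << a >> * << FMonom m >> :> tensor.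
  by rewrite /to_tensor linextU malgMU fmuE /= [mmul _ _]fmmulE.
by rewrite -M0_tact_pi [Psi _]Psi_act IHm.
Qed.

End Universal.

End Loop.
Section Layer.
Context (k : fieldType) (n : nat).

Definition in_layer : {pred M0 k} :=
  fun v => M0_act (loop_h k 0) v == - (2 * n)%:R *: v.

Lemma in_layer_submod : submod_closed in_layer.
Proof.
have actL := lie_linearr (M0_lie_module k) (loop_h k 0).
split=> [|c u v /eqP Hu /eqP Hv]; apply/eqP.
  exact: etrans (linear_fun0 actL) (esym (scaler0 _ _)).
apply: etrans (actL c u v) _; rewrite Hu Hv scalerDr !scalerA.
by rewrite [c * _]mulrC.
Qed.
HB.instance Definition _ :=
  GRing.isSubmodClosed.Build k (M0 k) in_layer in_layer_submod.

Record layer := Layer { layer_val : M0 k; _ : layer_val \in in_layer }.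
HB.instance Definition _ := [isSub for layer_val].
HB.instance Definition _ := [Choice of layer by <:].
HB.instance Definition _ := [SubChoice_isSubZmodule of layer by <:].
HB.instance Definition _ := [SubZmodule_isSubLmodule of layer by <:].

(* f(chi_1) ... f(chi_n) u_0 *)
Definition f_prod_M0 (chi : expo n) : M0 k :=
  foldr (fun i v => M0_act (loop_f k (chi i)) v) (u0 k) (enum 'I_n).

Lemma loop_bracket_h0f j :
  loop_bracket (loop_h k 0) (loop_f k j) = - 2%:R *: loop_f k j.
Proof.
rewrite /loop_h /loop_f !at_powU loop_bracketU /= add0r -at_powU -scaleNr.
exact: (linear_funZ (at_pow_linear j)).
Qed.

Lemma weight_step (V : lmodType k) (x y : V) (m : nat) :
  - 2%:R *: y = x - (- (2 * m)%:R *: y) -> x = - (2 * m.+1)%:R *: y.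
Proof.
by move/eqP; rewrite eq_sym subr_eq -scalerDl -opprD -natrD -mulnS => /eqP.
Qed.

Lemma f_prod_in_layer chi : f_prod_M0 chi \in in_layer.
Proof.
apply/eqP; rewrite /f_prod_M0.
have -> : (2 * n)%N = (2 * size (enum 'I_n))%N by rewrite size_enum_ord.
elim: (enum 'I_n) => [|i s IHs] /=.
  rewrite muln0 oppr0 scale0r; apply: M0_act_u0 => a.
  by rewrite /loop_h at_powU msuppU oner_eq0 inE => /eqP ->.
have [Ll Lr LB] := M0_lie_module k.
set v := foldr _ _ _ in IHs *; set f := loop_f k _.
have E1 : M0_act (- 2%:R *: f) v = - 2%:R *: M0_act f v.
  exact: linear_funZ (Ll v) _ _.
have E2 : M0_act f (M0_act (loop_h k 0) v)
          = - (2 * size s)%:R *: M0_act f v.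
  exact: etrans (congr1 (M0_act f) IHs) (linear_funZ (Lr f) _ _).
apply: weight_step; apply: etrans (esym E1) _.
apply: etrans _ (congr1 (fun z => _ - z) E2).
apply: etrans (congr1 (fun x => M0_act x v) (esym (loop_bracket_h0f _))) _.
exact: (LB (loop_h k 0) f v).
Qed.

Definition f_prod (chi : expo n) : layer := Layer (f_prod_in_layer chi).

Definition layer_deg (d : int) (v : layer) : Prop :=
  exists s : seq (k * expo n),
    all (fun a => expo_deg a.2 == d) s /\
    v = \sum_(a <- s) a.1 *: f_prod a.2.

(* m(gamma).f(chi_1)...f(chi_n) u_0 =
     1/n! sum_(s in Sym(n)) f(chi_1 + gamma_(s 1)) ... f(chi_n + gamma_(s n)) u_0 *)
Definition layer_action (act : sym_laurent k n -> layer -> layer) : Prop :=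
  [/\ forall v, linear (act^~ v),
      forall a, linear (act a)
    & forall gamma chi : expo n,
        act (msym k gamma) (f_prod chi) =
        (n`!%:R)^-1 *: \sum_(s : 'S_n) f_prod [ffun i => chi i + gamma (s i)]].

End Layer.

Section Graded.
Context (k : fieldType).

(* deg d v states that v belongs to the component of degree d. *)
Definition grading (V : lmodType k) (deg : int -> V -> Prop) : Prop :=
  [/\ forall d, deg d 0 /\
        (forall c u v, deg d u -> deg d v -> deg d (c *: u + v)),
      forall v, exists (D : seq int) (c : int -> V),
        (forall d, deg d (c d)) /\ v = \sum_(d <- D) c d
    & forall (D : seq int) (c : int -> V), uniq D ->
        (forall d, deg d (c d)) -> \sum_(d <- D) c d = 0 ->
        forall d, d \in D -> c d = 0].

Definition graded_algebra (A : comAlgType k) (degA : int -> A -> Prop) : Prop :=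
  [/\ grading degA, degA 0 1
    & forall d e a b, degA d a -> degA e b -> degA (d + e) (a * b)].

Definition graded_module (A : comAlgType k) (degA : int -> A -> Prop)
    (V : lmodType k) (act : A -> V -> V) (degV : int -> V -> Prop) : Prop :=
  [/\ [/\ forall v, linear (act^~ v), forall a, linear (act a),
          forall v, act 1 v = v
        & forall a b v, act (a * b) v = act a (act b v)],
      grading degV
    & forall d e a v, degA d a -> degV e v -> degV (d + e) (act a v)].

Definition graded_module_iso (A : comAlgType k)
    (V : lmodType k) (actV : A -> V -> V) (degV : int -> V -> Prop)
    (W : lmodType k) (actW : A -> W -> W) (degW : int -> W -> Prop)
    (Theta : {linear V -> W}) : Prop :=
  [/\ bijective Theta,
      forall a v, Theta (actV a v) = actW a (Theta v)
    & forall d v, degV d v <-> degW d (Theta v)].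

End Graded.

(* Main.v *)
(* A module structure on the polynomial ring in variables f(j) is built by letting
   f(j) act by multiplication and forcing the commutators of h(j) and e(j) with
   multiplication by f(i); the remaining relations hold because both sides have
   the same commutators with the f(i) and the same value at 1.  The universal
   property of M(0) maps it to this module, which is what makes Theta well
   defined.  Conversely f(chi) |-> f(chi) u_0 defines a map of loop modules to
   M(0), and uniqueness in the universal property shows that the composite
   endomorphism of M(0) is the identity, so that the f(chi) u_0 span.  The
   inverse of Theta sends a symmetric Laurent polynomial sum_chi c_chi z^chi to
   sum_chi c_chi f(chi) u_0, and the module structures match because
   m(gamma) m(chi) is the average over s of the m(chi + gamma o s). *)
Require Import Defs.
From HB Require Import structures.
From mathcomp Require Import all_boot all_order all_algebra all_fingroup.
From mathcomp Require Import finmap monalg.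

Set Implicit Arguments.
Unset Strict Implicit.
Unset Printing Implicit Defensive.

Import GRing.Theory.
Local Open Scope ring_scope.

(** * Permutation invariance and linear extensionality *)

(** Swaps of the two leading letters, applied under longer and longer prefixes, bring any chosen
    letter to the front; induction on [s] then treats the tails. *)
Lemma perm_swap_ind (T : eqType) (V : Type) (A : seq T -> V) :
  (forall i s t, A s = A t -> perm_eq s t -> A (i :: s) = A (i :: t)) ->
  (forall i j s, A [:: i, j & s] = A [:: j, i & s]) ->
  forall s t, perm_eq s t -> A s = A t.
Proof.
move=> Ac As.
have Pmid (i : T) t1 t2 : perm_eq (t1 ++ i :: t2) (i :: t1 ++ t2).
  by apply/seq.permP => p; rewrite /= !count_cat /= addnCA.
have Amid i t1 t2 : A (t1 ++ i :: t2) = A (i :: t1 ++ t2).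
  by elim: t1 => //= x t1 IH; rewrite -As; apply: Ac.
elim=> [|i s IHs] t st; first by move: st; rewrite perm_sym => /perm_nilP ->.
have /path.splitPr it : i \in t by rewrite -(perm_mem st) mem_head.
case: it st => t1 t2 st.
have st' : perm_eq s (t1 ++ t2) by rewrite -(perm_cons i) (perm_trans st).
by rewrite Amid; apply: Ac => //; apply: IHs.
Qed.

Lemma linear_malg_eq (k : fieldType) (K : choiceType) (V : lmodType k)
    (A B : {malg k[K]} -> V) : linear A -> linear B ->
  (forall a, A << a >> = B << a >>) -> A =1 B.
Proof.
move=> LA LB AB; apply: malg_lind => [c u v Eu Ev||a]; last exact: AB.
- by rewrite LA LB Eu Ev.
- by rewrite (linear_fun0 LA) (linear_fun0 LB).
Qed.

(** * Commutation relations of the operators on words *)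

(* F i stands for multiplication by f(i), b s for the monomial with factors f(i),
   i in s.  Write H j and E j for the operators with H j (b s) = word_h j s and
   E j (b s) = word_e j s: the two recursions say that [H j, F i] = -2 F (i + j),
   that [E j, F i] = H (i + j), and that H j and E j kill b [::]. *)
Section WordOperators.
Context (k : fieldType) (V : lmodType k) (F : int -> {linear V -> V}).
Context (b : seq int -> V).
Hypotheses (b_perm : forall s t, perm_eq s t -> b s = b t).
Hypotheses (F_b : forall i s, F i (b s) = b (i :: s)).

Fixpoint word_h (j : int) (s : seq int) : V :=
  if s is i :: s' then F i (word_h j s') - 2%:R *: b ((i + j)%R :: s') else 0.

Fixpoint word_e (j : int) (s : seq int) : V :=
  if s is i :: s' then F i (word_e j s') + word_h (i + j) s' else 0.

Lemma word_h0 s : word_h 0 s = - (2 * size s)%:R *: b s.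
Proof.
elim: s => [|i s IHs] /=; first by rewrite muln0 oppr0 scale0r.
rewrite IHs linearZ_LR /= F_b addr0 -scalerBl mulnS.
by rewrite (natrD _ 2) -opprD addrC.
Qed.

Hypotheses (b_span : forall (A B : V -> V), linear A -> linear B ->
  (forall s, A (b s) = B (b s)) -> A =1 B).

Lemma word_fC i j v : F i (F j v) = F j (F i v).
Proof.
move: v; apply: b_span => [c u v|c u v|s]; rewrite ?linearP //.
by rewrite !F_b; apply: b_perm; rewrite (perm_catCA [:: i] [:: j]).
Qed.

(** Makes [H j] well defined on monomials. Expanding two leading letters gives a term [F i (F l _)],
    symmetric because the [F] commute, and two shifted words that a swap exchanges up to
    reordering. *)
Lemma word_h_perm j s t : perm_eq s t -> word_h j s = word_h j t.
Proof.
move: s t; apply: perm_swap_ind => [i s t /= -> st|i l s /=].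
  by congr (_ - _ *: _); apply: b_perm; rewrite perm_cons.
rewrite !linearB !linearZ /= (word_fC l i) -!addrA !F_b.
congr (_ + _); rewrite addrC; congr (_ *: - _ + _ *: - _).
  by apply: b_perm; rewrite (perm_catCA [:: _] [:: _]).
by apply: b_perm; rewrite (perm_catCA [:: _] [:: _]).
Qed.

(** Expanding two leading letters leaves [F i (F l _)], the cross terms [F i (word_h (l + j) s)] and
    [F l (word_h (i + j) s)], and -2 times the word [(i + l + j) :: s]; the total is symmetric in
    [i] and [l]. *)
Lemma word_e_perm j s t : perm_eq s t -> word_e j s = word_e j t.
Proof.
move: s t; apply: perm_swap_ind =>
  [i s t /= -> /(word_h_perm (i + j)) -> //|i l s /=].
rewrite !linearD /= (word_fC l i) -!addrA; congr (_ + _).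
rewrite !addrA (addrC (F i _)); congr (_ + _ - _ *: b (_ :: s)).
by rewrite (addrC l i).
Qed.

Context (H E : int -> {linear V -> V}).
Hypotheses (H_b : forall j s, H j (b s) = word_h j s).
Hypotheses (E_b : forall j s, E j (b s) = word_e j s).

Lemma word_hf i j v : H i (F j v) = F j (H i v) - 2%:R *: F (i + j) v.
Proof.
move: v; apply: b_span => [c u v|c u v|s]; first by rewrite !linearP.
  by rewrite !linearP /= scalerDr addrACA.
by rewrite !F_b !H_b /= [j + i]addrC.
Qed.

Lemma word_ef i j v : E i (F j v) = F j (E i v) + H (i + j) v.
Proof.
move: v; apply: b_span => [c u v|c u v|s]; first by rewrite !linearP.
  by rewrite !linearP /= scalerDr addrACA.
by rewrite F_b !H_b !E_b /= [j + i]addrC.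
Qed.

(** [Z] moves past every [F i] until it meets the vacuum [b [::]]. This is applied below to the
    defect of each remaining bracket relation. *)
Lemma word_eq0 (Z : V -> V) : linear Z -> Z (b [::]) = 0 ->
  (forall i v, Z (F i v) = F i (Z v)) -> Z =1 (fun=> 0).
Proof.
move=> LZ Z0 ZF; apply: b_span => // [c u v|].
  by rewrite scaler0 addr0.
by elim=> // i s IHs; rewrite -F_b ZF IHs linear0.
Qed.

(** By the Jacobi identity the commutator of [[H i, H j]] with [F l] is 4 [F (i + j + l)] minus
    itself, so [word_eq0] applies. *)
Lemma word_hh i j v : H i (H j v) - H j (H i v) = 0.
Proof.
move: v; apply: word_eq0 => [c u v||l v].
- by rewrite !linearP /= scalerDr addrACA.
- by rewrite !H_b !linear0 addr0.
rewrite !word_hf !(linearB (H _)) /= !(linearZZ (H _)) !word_hf.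
rewrite [j + (i + l)]addrCA (linearB (F l)) /=.
(* The first pair is the right-hand side; each of the other three pairs cancels. *)
rewrite !scalerBr !opprD !opprK !addrA [LHS](ACl ((1*5)*(2*7)*(3*6)*(4*8))) /=.
by rewrite !addNr !subrr !addr0.
Qed.

(** The defect commutes with [F l]: both [[[H i, E j], F l]] and [[2 E (i + j), F l]] equal 2
    [H (i + j + l)]. The first uses that [H i] and [H (j + l)] commute. *)
Lemma word_he i j v :
  H i (E j v) - E j (H i v) = 2%:R *: E (i + j) v.
Proof.
apply/eqP; rewrite -subr_eq0; apply/eqP.
move: v; apply: word_eq0 => [c u v||l v].
- by rewrite !linearP /= !scalerDr !addrA (ACl (1*3*5*2*4*6)).
- by rewrite !E_b !H_b !linear0 !addr0.
have := word_hh i (j + l) v; move/subr0_eq => hh.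
rewrite !word_ef !word_hf !(linearD (H _)) !(linearB (E _)) /=
  !(linearZZ (E _)) /= !word_hf !word_ef.
rewrite -hh !(linearB (F l)) (linearZZ (F l)) /= [j + (i + l)]addrCA.
rewrite -[i + j + l]addrA.
rewrite !scalerDr !opprD !opprK !addrA.
rewrite [LHS](ACl ((1*4*8)*((2*6)*(3*5)*(7*9)))) /=.
by rewrite addNr !subrr !addr0.
Qed.

(** The commutator of [[E i, E j]] with [F l] is [[E i, H (j + l)] - [E j, H (i + l)]], whose two
    terms cancel by [word_he]. *)
Lemma word_ee i j v : E i (E j v) - E j (E i v) = 0.
Proof.
move: v; apply: word_eq0 => [c u v||l v].
- by rewrite !linearP /= scalerDr addrACA.
- by rewrite !E_b !linear0 addr0.
rewrite !word_ef !(linearD (E _)) /= !word_ef !(linearB (F _)) /=.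
rewrite !opprD !addrA [LHS](ACl ((1*4)*((2*6)*(3*5)))) /=.
rewrite word_he -[E i _ - _]opprB word_he [j + l + i]addrC [j + l]addrC.
by rewrite -[i + l + j]addrA subrr addr0.
Qed.
End WordOperators.

(** * The polynomial ring in the f(j) as a module over the loop algebra *)

Section FockModule.
Context (k : fieldType).

(* A multiset of integers is represented by its sorted list of elements. *)
Definition multiset : Type := {s : seq int | sorted <=%O s}.

Lemma sort_int_sorted (s : seq int) : sorted <=%O (sort <=%O s).
Proof. exact/sort_sorted/Order.TotalTheory.le_total. Qed.

Definition to_multiset (s : seq int) : multiset :=
  Sub (sort <=%O s) (sort_int_sorted s).

Lemma to_multisetP s t : reflect (to_multiset s = to_multiset t) (perm_eq s t).
Proof.
apply: (iffP (perm_sortP Order.TotalTheory.le_total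
  Order.POrderTheory.le_trans Order.POrderTheory.le_anti _ _)).
- by move=> e; apply/val_inj.
- by case.
Qed.

Lemma perm_multiset s : perm_eq (val (to_multiset s)) s.
Proof. exact/permPl/perm_sort. Qed.

Lemma to_multisetK (m : multiset) : to_multiset (val m) = m.
Proof.
by apply/val_inj/sorted_sort;
  [exact: Order.POrderTheory.le_trans | exact: valP].
Qed.

(** The polynomial ring in the variables f(j): a monomial is the multiset of the indices of its
    factors. *)
Definition fock : lmodType k := {malg k[multiset]}.
Definition fock_word (s : seq int) : fock := << to_multiset s >>.

Definition fock_f (i : int) : {linear fock -> fock} :=
  linext (fun m : multiset => fock_word (i :: val m)).
Definition fock_h (j : int) : {linear fock -> fock} :=
  linext (fun m : multiset => word_h fock_f fock_word j (val m)).
Definition fock_e (j : int) : {linear fock -> fock} :=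
  linext (fun m : multiset => word_e fock_f fock_word j (val m)).

Lemma fock_word_perm s t : perm_eq s t -> fock_word s = fock_word t.
Proof. by move=> /to_multisetP st; rewrite /fock_word st. Qed.

Lemma fock_linear_eq (V : lmodType k) (A B : fock -> V) :
    linear A -> linear B ->
  (forall s, A (fock_word s) = B (fock_word s)) -> A =1 B.
Proof.
move=> LA LB AB; apply: linear_malg_eq => // m.
by rewrite -[m]to_multisetK; apply: AB.
Qed.

Lemma fock_f_word i s : fock_f i (fock_word s) = fock_word (i :: s).
Proof.
by rewrite [LHS]linextU; apply: fock_word_perm; rewrite perm_cons perm_multiset.
Qed.

(** The definition evaluates the recursion on the sorted representative; permutation invariance
    carries the value over to every word. *)
Lemma fock_h_word j s :
  fock_h j (fock_word s) = word_h fock_f fock_word j s.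
Proof.
rewrite [LHS]linextU;
  apply: (word_h_perm fock_word_perm fock_f_word (@fock_linear_eq _)).
exact: perm_multiset.
Qed.

Lemma fock_e_word j s :
  fock_e j (fock_word s) = word_e fock_f fock_word j s.
Proof.
rewrite [LHS]linextU;
  apply: (word_e_perm fock_word_perm fock_f_word (@fock_linear_eq _)).
exact: perm_multiset.
Qed.

Lemma fock_h0_word s :
  fock_h 0 (fock_word s) = - (2 * size s)%:R *: fock_word s.
Proof. exact: etrans (fock_h_word 0 s) (word_h0 fock_f_word s). Qed.

Definition fock_gen (a : sl2_basis * int) : {linear fock -> fock} :=
  match a.1 with
  | sl2_e => fock_e a.2 | sl2_f => fock_f a.2 | sl2_h => fock_h a.2
  end.

Definition fock_act (x : loop k) (v : fock) : fock :=
  linext (fun a => fock_gen a v) x.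

Lemma fock_act_gen a v : fock_act << a >> v = fock_gen a v.
Proof. exact: linextU. Qed.

Lemma fock_act_linearl v : linear (fock_act^~ v).
Proof. by move=> c x y; apply: linearP. Qed.

Lemma fock_act_linearr x : linear (fock_act x).
Proof.
move=> c u v; apply: etrans (eq_linext x _) (linext_fun _ _ c x) => a.
exact: linearP.
Qed.

Lemma loop_bracket_linearl y : linear ((@loop_bracket k)^~ y).
Proof. by move=> c x1 x2; apply: linearP. Qed.

Lemma loop_bracket_linearr x : linear (@loop_bracket k x).
Proof.
move=> c y1 y2; apply: etrans (eq_linext x _) (linext_fun _ _ c x) => a.
exact: linearP.
Qed.

Lemma fock_act_at_pow a j c v :
  fock_act (at_pow (c *: << a >>) j) v = c *: fock_gen (a, j) v.
Proof.
rewrite (linear_funZ (at_pow_linear j)) at_powU.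
by rewrite (linear_funZ (fock_act_linearl v)) fock_act_gen.
Qed.

Lemma fock_genB a b v :
  fock_act (at_pow (sl2_bracket k a.1 b.1) (a.2 + b.2)) v =
  fock_gen a (fock_gen b v) - fock_gen b (fock_gen a v).
Proof.
have b0 j : fock_act (at_pow 0 j) v = 0.
  by rewrite (linear_fun0 (at_pow_linear j)) (linear_fun0 (fock_act_linearl v)).
have b1 c j : fock_act (at_pow << c >> j) v = fock_gen (c, j) v.
  by rewrite -[<< c >> in LHS]scale1r fock_act_at_pow scale1r.
have bN c d j : fock_act (at_pow (- (d *: << c >>)) j) v =
  - (d *: fock_gen (c, j) v).
  by rewrite -[- (d *: << c >>)]scaleNr fock_act_at_pow scaleNr.
have bN1 c j : fock_act (at_pow (- << c >>) j) v = - fock_gen (c, j) v.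
  by rewrite -[<< c >> in LHS]scale1r bN scale1r.
have Hf := word_hf fock_f_word (@fock_linear_eq _) fock_h_word.
have Ef := word_ef fock_f_word (@fock_linear_eq _) fock_h_word fock_e_word.
have FC := word_fC fock_word_perm fock_f_word (@fock_linear_eq _).
have HH := word_hh fock_f_word (@fock_linear_eq _) fock_h_word.
have HE := word_he fock_f_word (@fock_linear_eq _) fock_h_word fock_e_word.
have EE := word_ee fock_f_word (@fock_linear_eq _) fock_h_word fock_e_word.
(* Nine cases, with both letters running through e, f, h in this order; each is one of the
   commutators above up to sign. *)
case: a b => [[] i] [[] j] /=;
  rewrite ?(b0, b1, bN, bN1, fock_act_at_pow) /fock_gen /=.
- by rewrite EE.
- by rewrite Ef addrAC subrr add0r.
- by rewrite -opprB HE addrC.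
- by rewrite Ef opprD addrA subrr add0r addrC.
- by apply/esym/eqP; rewrite subr_eq0; apply/eqP; apply: FC.
- by rewrite Hf opprD opprK addrA subrr add0r addrC.
- by rewrite HE.
- by rewrite Hf addrAC subrr add0r.
- by rewrite HH.
Qed.

Lemma fock_lie_module : lie_module fock_act.
Proof.
split; [exact: fock_act_linearl | exact: fock_act_linearr |].
move=> x y v; move: x; apply: linear_malg_eq => [c x1 x2|c x1 x2|a].
- by rewrite loop_bracket_linearl fock_act_linearl.
- rewrite !fock_act_linearl fock_act_linearr scalerBr opprD.
  exact: addrACA.
move: y; apply: linear_malg_eq => [c y1 y2|c y1 y2|b].
- by rewrite loop_bracket_linearr fock_act_linearl.
- rewrite !fock_act_linearl fock_act_linearr scalerBr opprD.
  exact: addrACA.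
apply: etrans (congr1 (fun x : loop k => fock_act x v) (loop_bracketU k a b)) _.
apply: etrans (fock_genB a b v) _.
have E c d : fock_gen c (fock_gen d v) = fock_act << c >> (fock_act << d >> v).
  by apply: etrans (esym (fock_act_gen c _)) _; congr fock_act;
    rewrite fock_act_gen.
by congr (_ - _); apply: E.
Qed.

Lemma fock_act_borel x : borel x -> fock_act x (fock_word [::]) = 0.
Proof.
move=> bx; rewrite /fock_act /linext big_seq big1 // => -[[] j] /bx //= _.
- by rewrite /fock_gen /= fock_e_word scaler0.
- by rewrite /fock_gen /= fock_h_word scaler0.
Qed.
End FockModule.

Lemma pchar0_natr_neq (R : fieldType) (m n : nat) : [pchar R] =i pred0 ->
  m != n -> m%:R != n%:R :> R.
Proof.
move=> /pcharf0P nat0; wlog lt_nm : m n / (n < m)%N => [W|_].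
  by case: (ltngtP m n) => // ltmn _; [rewrite eq_sym|]; apply: W;
    rewrite // gtn_eqF.
by rewrite -subr_eq0 -natrB 1?ltnW // nat0 subn_eq0 -ltnNge.
Qed.

(** * Comparison of M(0) with the polynomial ring *)

Section InducedModule.
Context (k : fieldType).

Definition f_word (s : seq int) : M0 k :=
  foldr (fun j v => M0_act (loop_f k j) v) (u0 k) s.

Lemma M0_actC x y v :
  M0_act x (M0_act y v) = M0_act y (M0_act x v) + M0_act (loop_bracket x y) v
    :> M0 k.
Proof. by rewrite (lie_bracket (M0_lie_module k)) addrC subrK. Qed.

Lemma loop_bracket_ff i j : loop_bracket (loop_f k i) (loop_f k j) = 0.
Proof.
by rewrite /loop_f !at_powU loop_bracketU; apply: linear_fun0 (at_pow_linear _).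
Qed.

Lemma loop_bracket_hf i j :
  loop_bracket (loop_h k i) (loop_f k j) = - 2%:R *: loop_f k (i + j).
Proof.
rewrite /loop_f /loop_h !at_powU loop_bracketU /= -scaleNr -at_powU.
exact: linear_funZ (at_pow_linear _) _ _.
Qed.

Lemma loop_bracket_ef i j :
  loop_bracket (loop_e k i) (loop_f k j) = loop_h k (i + j).
Proof. by rewrite /loop_f /loop_e !at_powU loop_bracketU. Qed.

Lemma M0_act_ff i j v : M0_act (loop_f k i) (M0_act (loop_f k j) v) =
  M0_act (loop_f k j) (M0_act (loop_f k i) v).
Proof.
have E0 : M0_act (loop_bracket (loop_f k i) (loop_f k j)) v = 0.
  apply: etrans (congr1 (fun x => M0_act x v) (loop_bracket_ff i j)) _.
  exact: linear_fun0 (lie_linearl (M0_lie_module k) v).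
apply: etrans (M0_actC (loop_f k i) (loop_f k j) v) _.
exact: etrans (congr1 (fun x => _ + x) E0) (addr0 _).
Qed.

Lemma M0_act_hf i j v : M0_act (loop_h k i) (M0_act (loop_f k j) v) =
  M0_act (loop_f k j) (M0_act (loop_h k i) v) -
    2%:R *: M0_act (loop_f k (i + j)) v.
Proof.
have E2 : M0_act (loop_bracket (loop_h k i) (loop_f k j)) v =
    - (2%:R *: M0_act (loop_f k (i + j)) v).
  apply: etrans (congr1 (fun x => M0_act x v) (loop_bracket_hf i j)) _.
  rewrite -scaleNr.
  exact: linear_funZ (lie_linearl (M0_lie_module k) v) _ _.
apply: etrans (M0_actC (loop_h k i) (loop_f k j) v) _.
exact: (congr1 (+%R (M0_act (loop_f k j) (M0_act (loop_h k i) v))) E2).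
Qed.

Lemma M0_act_ef i j v : M0_act (loop_e k i) (M0_act (loop_f k j) v) =
  M0_act (loop_f k j) (M0_act (loop_e k i) v) + M0_act (loop_h k (i + j)) v.
Proof.
apply: etrans (M0_actC (loop_e k i) (loop_f k j) v) _.
exact: (congr1
  (fun x => M0_act (loop_f k j) (M0_act (loop_e k i) v) + M0_act x v)
  (loop_bracket_ef i j)).
Qed.

Lemma f_word_perm s t : perm_eq s t -> f_word s = f_word t.
Proof.
by move: s t; apply: perm_swap_ind => [i s t /= -> //|i j s]; apply: M0_act_ff.
Qed.

Definition fock_to_M0 : {linear fock k -> M0 k} :=
  linext (fun m : multiset => f_word (val m)).

Lemma fock_to_M0_word s : fock_to_M0 (fock_word k s) = f_word s.
Proof. by rewrite [LHS]linextU; apply/f_word_perm/perm_multiset. Qed.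

Lemma fock_to_M0_f i v :
  fock_to_M0 (fock_f k i v) = M0_act (loop_f k i) (fock_to_M0 v).
Proof.
move: v; apply: fock_linear_eq => [c u v|c u v|s]; first by rewrite !linearP.
  by rewrite linearP (lie_linearr (M0_lie_module k)).
rewrite fock_to_M0_word; apply: etrans (fock_to_M0_word (i :: s)).
exact: (congr1 fock_to_M0 (fock_f_word k i s)).
Qed.

Lemma borel_gen (x : sl2_basis) j : x <> sl2_f -> borel (<< (x, j) >> : loop k).
Proof. by move=> xf a; rewrite msuppU oner_eq0 inE => /eqP ->. Qed.

Lemma M0_act_u0_h j : M0_act (loop_h k j) (u0 k) = 0.
Proof. by apply: M0_act_u0; rewrite /loop_h at_powU; apply: borel_gen. Qed.

Lemma M0_act_u0_e j : M0_act (loop_e k j) (u0 k) = 0.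
Proof. by apply: M0_act_u0; rewrite /loop_e at_powU; apply: borel_gen. Qed.

(** The recursion of [word_h] records what moving h(j) rightwards through the factors f(i) produces,
    and h(j) kills [u0]. *)
Lemma fock_to_M0_h j s : fock_to_M0 (word_h (fock_f k) (fock_word k) j s) =
  M0_act (loop_h k j) (f_word s).
Proof.
elim: s => [|i s IHs]; first by rewrite /= linear0 M0_act_u0_h.
apply: etrans (linearB _ _ _) _; rewrite linearZZ fock_to_M0_f IHs.
by rewrite fock_to_M0_word [i + j]addrC; apply/esym/M0_act_hf.
Qed.

Lemma fock_to_M0_e j s : fock_to_M0 (word_e (fock_f k) (fock_word k) j s) =
  M0_act (loop_e k j) (f_word s).
Proof.
elim: s => [|i s IHs]; first by rewrite /= linear0 M0_act_u0_e.
apply: etrans (linearD _ _ _) _; rewrite fock_to_M0_f IHs fock_to_M0_h.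
by rewrite [i + j]addrC; apply/esym/M0_act_ef.
Qed.

Lemma fock_to_M0_act x v : fock_to_M0 (fock_act x v) = M0_act x (fock_to_M0 v).
Proof.
have [Ll Lr _] := M0_lie_module k.
move: x; apply: linear_malg_eq => [c x y|c x y|a].
- by rewrite fock_act_linearl linearP.
- by rewrite Ll.
move: v; apply: fock_linear_eq => [c u v|c u v|s].
- by rewrite fock_act_linearr linearP.
- by rewrite linearP Lr.
rewrite fock_to_M0_word; apply: etrans (congr1 fock_to_M0 (fock_act_gen a _)) _.
case: a => x j; rewrite -(at_powU k x j); case: x; rewrite /fock_gen /=.
- exact: etrans (congr1 fock_to_M0 (fock_e_word k j s)) (fock_to_M0_e j s).
- by rewrite fock_to_M0_f fock_to_M0_word.
- exact: etrans (congr1 fock_to_M0 (fock_h_word k j s)) (fock_to_M0_h j s).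
Qed.

(** The third clause makes [Phi] injective and [fock_to_M0] surjective: words in the f(j) span M(0),
    and linear independence can be read off in [fock]. *)
Lemma M0_fock_embedding : exists Phi : {linear M0 k -> fock k},
  [/\ forall s, Phi (f_word s) = fock_word k s,
      forall x v, Phi (M0_act x v) = fock_act x (Phi v)
    & forall v, fock_to_M0 (Phi v) = v].
Proof.
have [Phi [Phi_u0 Phi_act _]] :=
  M0_universal (fock_lie_module k) (@fock_act_borel k).
exists Phi; split; [|exact: Phi_act|].
  elim=> [|j s IHs]; first exact: Phi_u0.
  apply: etrans (Phi_act (loop_f k j) (f_word s)) _; rewrite IHs.
  have E := congr1 (fun x => fock_act x (fock_word k s)) (at_powU k sl2_f j).
  apply: etrans E _.
  exact: etrans (fock_act_gen (sl2_f, j) _) (fock_f_word k j s).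
(* The target is now M(0) itself with the vector [u0]: the composite and the identity are both the
   unique morphism fixing [u0]. *)
have [Id [_ _ Id_uniq]] := M0_universal (M0_lie_module k) (@M0_act_u0 k).
pose PhiM : {linear M0 k -> M0 k} := [the {linear _ -> _} of fock_to_M0 \o Phi].
have PhiM_u0 : PhiM (u0 k) = u0 k.
  exact: etrans (congr1 fock_to_M0 Phi_u0) (fock_to_M0_word [::]).
have PhiM_act x w : PhiM (M0_act x w) = M0_act x (PhiM w).
  exact: etrans (congr1 fock_to_M0 (Phi_act x w)) (fock_to_M0_act x _).
move=> v; apply: etrans (Id_uniq PhiM PhiM_u0 PhiM_act v) _.
exact: esym (Id_uniq idfun (erefl _) (fun _ _ => erefl _) v).
Qed.
End InducedModule.

(** * The n-th layer: spanning vectors and existence of Theta *)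

Section Layer.
Context (k : fieldType) (k_char0 : [pchar k] =i pred0) (n : nat).

(** Words shorter than [n] are padded with the default 0; [word_expo] is evaluated on words of
    length exactly [n]. *)
Definition word_expo (s : seq int) : expo n := [ffun i : 'I_n => s`_i].

Lemma f_prod_f_word (chi : expo n) :
  layer_val (f_prod k chi) = f_word k [seq chi i | i <- enum 'I_n].
Proof. by rewrite /f_word foldr_map. Qed.

Lemma expo_wordK (chi : expo n) : word_expo [seq chi i | i <- enum 'I_n] = chi.
Proof.
apply/ffunP => i; rewrite ffunE (nth_map i) ?nth_ord_enum //.
by rewrite size_enum_ord.
Qed.

Lemma word_expoK (s : seq int) : size s = n ->
  [seq word_expo s i | i <- enum 'I_n] = s.
Proof.
move=> sn; rewrite (eq_map (g := nth 0 s \o val)) => [|i];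
  last by rewrite ffunE.
by rewrite map_comp val_enum_ord -sn map_nth_iota0 // take_size.
Qed.

Lemma f_prod_word_expo (s : seq int) : size s = n ->
  layer_val (f_prod k (word_expo s)) = f_word k s.
Proof. by move=> sn; rewrite f_prod_f_word word_expoK. Qed.

Lemma f_prod_perm (chi : expo n) (s : 'S_n) :
  f_prod k [ffun i => chi (s i)] = f_prod k chi.
Proof.
apply/val_inj; rewrite /= -[LHS]/(layer_val (f_prod k _)).
rewrite -[RHS]/(layer_val (f_prod k _)).
rewrite !f_prod_f_word; apply: f_word_perm.
rewrite (eq_map (g := chi \o s)); last by move=> i; rewrite ffunE.
rewrite map_comp; apply: perm_map; apply: uniq_perm.
- by rewrite map_inj_uniq ?enum_uniq //; apply: perm_inj.
- exact: enum_uniq.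
by move=> i; rewrite mem_enum; apply/mapP; exists ((s^-1)%g i);
  rewrite ?mem_enum ?permKV.
Qed.

Lemma layer_val_linear : linear (@layer_val k n).
Proof. by []. Qed.

Definition fock_to_layer : {linear fock k -> layer k n} :=
  linext (fun m : multiset =>
    if size (val m) == n then f_prod k (word_expo (val m)) else 0).

(** Words of length m have weight -2m, and in characteristic zero these weights are distinct, so a
    vector of weight -2n involves only words of length [n]. *)
Lemma fock_layerK (g : fock k) : fock_h k 0 g = - (2 * n)%:R *: g ->
  layer_val (fock_to_layer g) = fock_to_M0 k g.
Proof.
move=> hg.
(* The eigenvalue of h(0) + 2n on words of length [m]. *)
pose c m : k := (2 * n)%:R - (2 * m)%:R.
(* R inverts h(0) + 2n away from the weight -2n. *)
pose R : {linear fock k -> M0 k} := linext (fun m : multiset =>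
  if size (val m) == n then 0 else (c (size (val m)))^-1 *: f_word k (val m)).
have c_neq0 m : m != n -> c m != 0.
  by move=> mn; rewrite subr_eq0; apply: pchar0_natr_neq => //;
    rewrite eqn_pmul2l // eq_sym.
(* This identity is linear in [g], hence checked on monomials; the weight hypothesis makes its left
   side vanish. *)
suff RE : R (fock_h k 0 g + (2 * n)%:R *: g) =
  fock_to_M0 k g - layer_val (fock_to_layer g).
  by move: RE; rewrite hg scaleNr addNr linear0 => /esym/subr0_eq.
move: g {hg}; apply: linear_malg_eq => [a u v|a u v|m].
- rewrite !(linearP (fock_h k 0)) scalerDr scalerA mulrC -scalerA addrACA
  -scalerDr.
  exact: linearP.
- rewrite (linearP (fock_to_M0 k)) (linearP fock_to_layer) layer_val_linear
  scalerBr opprD; exact: addrACA.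
rewrite -[m]to_multisetK -/(fock_word k (val m)) fock_h0_word -scalerDl
  linearZ_LR.
rewrite fock_to_M0_word [- _ + _]addrC -/(c _) /fock_word to_multisetK.
have -> : R << m >> = _ := linextU _ m.
have -> : fock_to_layer << m >> = _ := linextU _ m.
case: eqVneq => [mn|mn].
  by rewrite scaler0 f_prod_word_expo // subrr.
by rewrite scalerA divff ?c_neq0 // scale1r subr0.
Qed.

Lemma layer_fock (Phi : {linear M0 k -> fock k}) (v : layer k n) :
  (forall x v, Phi (M0_act x v) = fock_act x (Phi v)) ->
  (forall v, fock_to_M0 k (Phi v) = v) ->
  v = fock_to_layer (Phi (layer_val v)).
Proof.
move=> Phi_act Phi_K; apply/val_inj; rewrite /= fock_layerK ?Phi_K //.
have /eqP hv : layer_val v \in in_layer n by exact: valP.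
by rewrite -linearZ_LR -hv Phi_act /loop_h at_powU fock_act_gen.
Qed.

(** The [f_prod k chi] span the layer: each element is an image under [fock_to_layer], which sends
    every monomial to some [f_prod k chi] or to 0. *)
Lemma layer_ind (P : layer k n -> Prop) :
  (forall c u v, P u -> P v -> P (c *: u + v)) -> P 0 ->
  (forall chi, P (f_prod k chi)) -> forall v, P v.
Proof.
move=> PD P0 Pf v; have [Phi [_ Phi_act Phi_K]] := M0_fock_embedding k.
rewrite (layer_fock v Phi_act Phi_K).
elim/malg_lind: (Phi _) => [c g1 g2 IH1 IH2||m].
- by rewrite linearP; apply: PD.
- by rewrite linear0.
- by have -> : fock_to_layer << m >> = _ := linextU _ m; case: ifP.
Qed.

Lemma msym_perm (chi : expo n) (s : 'S_n) :
  msym k [ffun i => chi (s i)] = msym k chi.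
Proof.
apply/val_inj; congr (_ *: _); rewrite [LHS](reindex_inj (mulgI s)).
apply: eq_bigr => t _; rewrite [RHS](reindex_inj (@perm_inj _ s)).
by apply: eq_bigr => i _; rewrite ffunE permM.
Qed.

(** Well-definedness comes from passing through [fock], where the monomials form a basis and a
    linear map may be prescribed freely. *)
Lemma layer_to_sym_exists :
  exists Theta : {linear layer k n -> sym_laurent k n},
    forall chi, Theta (f_prod k chi) = msym k chi.
Proof.
have [Phi [Phi_w _ _]] := M0_fock_embedding k.
pose T0 : {linear fock k -> sym_laurent k n} := linext (fun m : multiset =>
    if size (val m) == n then msym k (word_expo (val m)) else 0).
pose T (v : layer k n) := T0 (Phi (layer_val v)).
have TL : linear T by move=> c u v; rewrite /T -!linearP.
pose TM := GRing.isLinear.Build k (layer k n) (sym_laurent k n) *:%R T TL.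
pose Theta : {linear layer k n -> sym_laurent k n} := HB.pack T TM.
exists Theta => chi; change (T (f_prod k chi) = msym k chi).
have -> : T (f_prod k chi) = T0 (fock_word k [seq chi i | i <- enum 'I_n]).
  by rewrite /T f_prod_f_word Phi_w.
set w := [seq _ | _ <- _];
  have sw : size w = n by rewrite size_map size_enum_ord.
have -> : T0 (fock_word k w) = _ := linextU _ (to_multiset w).
have ww := perm_multiset w; rewrite (perm_size ww) sw eqxx.
(* Sorting has permuted the entries of [chi] by some [s], which [msym] does not see. *)
have /tuple_permP[s ->] : perm_eq (val (to_multiset w)) [tuple chi i | i < n]
  by [].
rewrite -(msym_perm chi s); congr msym.
rewrite -[RHS]expo_wordK; congr word_expo.
by apply: eq_map => i; rewrite tnth_mktuple ffunE.
Qed.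
End Layer.

(** * Symmetrization, products and degrees of symmetric Laurent polynomials *)

Lemma linear_funD (k : fieldType) (V W : lmodType k) (f : V -> W) :
  linear f -> {morph f : u v / u + v}.
Proof. by move=> fL u v; have := fL 1 u v; rewrite !scale1r. Qed.

Section SymmetricLaurent.
Context (k : fieldType) (k_char0 : [pchar k] =i pred0) (n : nat).

Lemma fact_unit : n`!%:R != 0 :> k.
Proof. by move: k_char0 => /pcharf0P ->; rewrite -lt0n fact_gt0. Qed.

Lemma mean_const (V : lmodType k) (v : V) :
  (n`!%:R)^-1 *: (\sum_(s : 'S_n) v) = v.
Proof.
by rewrite sumr_const cardT -cardE card_Sn -scaler_nat scalerA mulVf
  ?fact_unit ?scale1r.
Qed.

Lemma prod_mono (I : finType) (f : I -> expo n) :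
  \prod_i mono k (f i) = mono k (\sum_i f i).
Proof.
by rewrite (big_morph (@mono k n) (id1 := 1) (op1 := *%R)) // => a b;
  rewrite monoM.
Qed.

Lemma msym_lperm (chi : expo n) :
  laurent_of (msym k chi) = (n`!%:R)^-1 *: \sum_(s : 'S_n) lperm s (mono k chi).
Proof.
congr (_ *: _); apply: eq_bigr => s _; rewrite prod_mono lpermU; congr mono.
apply/ffunP => j; rewrite sum_ffunE ffunE (bigD1 ((s^-1)%g j)) //= ffunE
  permKV eqxx.
rewrite big1 ?addr0 // => i ne; rewrite ffunE; case: eqP => // ji.
by rewrite ji permK eqxx in ne.
Qed.

(** The Reynolds operator of Sym(n). *)
Definition symmetrize (p : laurent k n) : laurent k n :=
  (n`!%:R)^-1 *: \sum_(s : 'S_n) lperm s p.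

Lemma symmetrize_linear : linear symmetrize.
Proof.
move=> c p q; rewrite /symmetrize scalerA mulrC -scalerA -scalerDr;
  congr (_ *: _).
rewrite scaler_sumr -big_split; apply: eq_bigr => s _; exact: linearP.
Qed.

Lemma symmetrizeM (p q : laurent k n) :
  p \in @symmetric_laurent k n -> symmetrize (p * q) = p * symmetrize q.
Proof.
move=> /symmetricP Sp; rewrite /symmetrize -scalerAr mulr_sumr; congr (_ *: _).
by apply: eq_bigr => s _; rewrite rmorphM /= Sp.
Qed.

(** Replacing each monomial of [p] by its m(chi) applies the Reynolds operator, which fixes
    symmetric polynomials. Hence the m(chi) span. *)
Lemma linext_msym (p : sym_laurent k n) : linext (@msym k n) (laurent_of p) = p.
Proof.
have SE (q : laurent k n) : laurent_of (linext (@msym k n) q) = symmetrize q.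
  move: q; apply: linear_malg_eq => [c u v||chi].
  - by rewrite linearP.
  - exact: symmetrize_linear.
  - by rewrite linextU msym_lperm.
apply/val_inj; apply: etrans (SE _) _; rewrite /symmetrize.
have /symmetricP Sp : laurent_of p \in @symmetric_laurent k n by exact: valP.
under eq_bigr => s _ do rewrite Sp.
exact: mean_const.
Qed.

Lemma sym_laurent_ind (P : sym_laurent k n -> Prop) :
  (forall c p q, P p -> P q -> P (c *: p + q)) -> P 0 ->
  (forall chi, P (msym k chi)) -> forall p, P p.
Proof.
move=> PD P0 Pm p; rewrite -(linext_msym p).
elim/malg_lind: (laurent_of p) => [c q r Pq Pr||chi].
- by rewrite linearP; apply: PD.
- by rewrite linear0.
- by rewrite linextU.
Qed.

(** Since the Reynolds operator is linear over symmetric polynomials, the product is the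
    symmetrization of [msym k gamma] times the single monomial [mono k chi]; expanding the first
    factor gives the sum. *)
Lemma msymM (gamma chi : expo n) : msym k gamma * msym k chi =
  (n`!%:R)^-1 *: \sum_(s : 'S_n) msym k [ffun i => chi i + gamma (s i)].
Proof.
apply/val_inj.
have symS q : laurent_of (msym k q) = symmetrize (mono k q) := msym_lperm q.
have sg : laurent_of (msym k gamma) \in @symmetric_laurent k n by exact: valP.
have -> : val (msym k gamma * msym k chi) =
  symmetrize (laurent_of (msym k gamma) * mono k chi).
  exact: etrans (congr1 ( *%R _) (symS chi)) (esym (symmetrizeM _ sg)).
pose c s : expo n := [ffun i => chi i + gamma (s i)].
have -> : val ((n`!%:R)^-1 *: \sum_(s : 'S_n) msym k (c s)) =
    (n`!%:R)^-1 *: \sum_(s : 'S_n) symmetrize (mono k (c s)).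
  rewrite linearZ raddf_sum; congr (_ *: _); apply: eq_bigr => s _; exact: symS.
have SL := symmetrize_linear.
have Ssum (I : Type) (r : seq I) (f : I -> laurent k n) :
    symmetrize (\sum_(i <- r) f i) = \sum_(i <- r) symmetrize (f i).
  exact: (big_morph symmetrize (linear_funD SL) (linear_fun0 SL)).
have -> : laurent_of (msym k gamma) * mono k chi =
    (n`!%:R)^-1 *: \sum_(s : 'S_n) (lperm s (mono k gamma) * mono k chi).
  apply: etrans (congr1 ( *%R^~ (mono k chi)) (msym_lperm gamma)) _.
  by apply: etrans (esym (scalerAl _ _ _)) _; rewrite mulr_suml.
apply: etrans (linear_funZ SL _ _) _; apply: (congr1 ( *:%R _)).
apply: etrans (Ssum _ _ _) _.
(* [lperm s] composes exponents with the inverse of [s], whereas the target composes with [s]. *)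
rewrite [LHS](reindex_inj invg_inj); apply: eq_bigr => s _.
rewrite lpermU monoM; congr (symmetrize (mono _ _)).
by apply/ffunP => i; rewrite !ffunE invgK addrC.
Qed.

Lemma expo_deg_perm (chi : expo n) (s : 'S_n) :
  expo_deg [ffun i => chi (s i)] = expo_deg chi.
Proof.
rewrite [RHS](reindex_inj (@perm_inj _ s)); apply: eq_bigr => i _.
by rewrite ffunE.
Qed.

Definition laurent_deg (d : int) (p : laurent k n) : Prop :=
  forall chi, p@_chi != 0 -> expo_deg chi = d.

Lemma sym_laurent_degP d (p : sym_laurent k n) :
  sym_laurent_deg d p <-> laurent_deg d (laurent_of p).
Proof.
by split=> H chi; [rewrite mcoeff_neq0|rewrite -mcoeff_neq0]; apply: H.
Qed.

Lemma laurent_degD d c p q : laurent_deg d p -> laurent_deg d q ->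
  laurent_deg d (c *: p + q).
Proof.
move=> dp dq chi; rewrite mcoeffD mcoeffZ => nz.
have [q0|/dq //] := eqVneq q@_chi 0.
by apply: dp; apply: contraNneq nz => ->; rewrite mulr0 q0 addr0.
Qed.

Lemma laurent_deg0 d : laurent_deg d 0.
Proof. by move=> chi; rewrite mcoeff0 eqxx. Qed.

Lemma laurent_deg_sum d (I : eqType) (r : seq I) (c : I -> k)
    (f : I -> laurent k n) :
  (forall i, i \in r -> laurent_deg d (f i)) ->
  laurent_deg d (\sum_(i <- r) c i *: f i).
Proof.
move=> df; rewrite big_seq; apply: (big_ind (laurent_deg d)).
- exact: laurent_deg0.
- by move=> u v du dv; rewrite -[u]scale1r; apply: laurent_degD.
- by move=> i /df dfi; rewrite -[_ *: _]addr0; apply: laurent_degD => //;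
  apply: laurent_deg0.
Qed.

Lemma laurent_deg_mono (chi : expo n) : laurent_deg (expo_deg chi) (mono k chi).
Proof.
by move=> a; rewrite mcoeff_neq0 msuppU oner_eq0 inE => /eqP ->.
Qed.

Lemma laurent_degM d e p q : laurent_deg d p -> laurent_deg e q ->
  laurent_deg (d + e) (p * q).
Proof.
move=> dp dq; have -> : p * q = \sum_(a <- msupp p) p@_a *:
    (\sum_(b <- msupp q) q@_b *: mono k (a + b)) by [].
apply: laurent_deg_sum => a ap; apply: laurent_deg_sum => b bq.
have <- : expo_deg (a + b) = d + e.
  rewrite -(dp a) ?mcoeff_neq0 // -(dq b) ?mcoeff_neq0 // -big_split.
  by apply: eq_bigr => i _; rewrite ffunE.
exact: laurent_deg_mono.
Qed.

Lemma sym_laurent_deg_msym (chi : expo n) :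
  sym_laurent_deg (expo_deg chi) (msym k chi).
Proof.
apply/sym_laurent_degP; rewrite msym_lperm scaler_sumr.
apply: laurent_deg_sum => s _; rewrite lpermU -(expo_deg_perm chi (s^-1)%g).
exact: laurent_deg_mono.
Qed.

Lemma sym_laurent_degD d c (p q : sym_laurent k n) :
  sym_laurent_deg d p -> sym_laurent_deg d q -> sym_laurent_deg d (c *: p + q).
Proof.
move=> /sym_laurent_degP dp /sym_laurent_degP dq; apply/sym_laurent_degP.
exact: laurent_degD.
Qed.

Lemma sym_laurent_deg0 d : sym_laurent_deg d (0 : sym_laurent k n).
Proof. by apply/sym_laurent_degP; apply: laurent_deg0. Qed.

Lemma sym_laurent_grading : grading (@sym_laurent_deg k n).
Proof.
split=> [d|p|D c uD cd c0 d dD].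
- by split; [exact: sym_laurent_deg0 | move=> *; apply: sym_laurent_degD].
(* The component of degree [d] collects the terms of degree [d] in the expansion of [p] into the
   m(chi). *)
- pose D := undup [seq expo_deg chi | chi <- msupp (laurent_of p)].
  pose c d := \sum_(chi <- msupp (laurent_of p) | expo_deg chi == d)
    (laurent_of p)@_chi *: msym k chi.
  exists D, c; split=> [d|].
    apply: big_ind => [|u v du dv|chi /eqP <-]; first exact: sym_laurent_deg0.
      by rewrite -[u]scale1r; apply: sym_laurent_degD.
    rewrite -[_ *: _]addr0; apply: sym_laurent_degD;
      last exact: sym_laurent_deg0.
    exact: sym_laurent_deg_msym.
  rewrite -[LHS]linext_msym /linext /c (exchange_big_dep xpredT) //=.
  rewrite !big_seq; apply: eq_bigr => chi chip.
  rewrite -big_filter (eq_filter (a2 := pred1 (expo_deg chi))) => [|d /=].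
    by rewrite filter_pred1_uniq ?undup_uniq ?big_seq1 // mem_undup map_f.
  exact: eq_sym.
(* A monomial occurring in [c d] has degree [d], so it occurs in no other component and its
   coefficient cannot cancel. *)
apply/val_inj/malgP => chi; rewrite mcoeff0; apply/eqP; case: eqVneq => // nz.
have := congr1 (fun p => (laurent_of p)@_chi) c0.
have sumE (r : seq int) : (laurent_of (\sum_(d <- r) c d))@_chi =
  \sum_(d <- r) (laurent_of (c d))@_chi.
  by rewrite -(raddf_sum (mcoeff chi)) -(raddf_sum val).
rewrite sumE (bigD1_seq d) //= big1 => [|e ne]; last first.
  apply/eqP; apply: contraNT ne => nze; apply/eqP.
  have /sym_laurent_degP/(_ chi nze) <- := cd e.
  by have /sym_laurent_degP/(_ chi nz) := cd d.
by move=> E; move: nz; rewrite -[_@__]addr0 E mcoeff0 eqxx.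
Qed.

Lemma sym_laurent_graded_algebra : graded_algebra (@sym_laurent_deg k n).
Proof.
split; first exact: sym_laurent_grading.
- apply/sym_laurent_degP.
  have <- : expo_deg (0 : expo n) = 0 by apply: big1 => i _; rewrite ffunE.
  exact: laurent_deg_mono.
- move=> d e a b /sym_laurent_degP da /sym_laurent_degP db;
  apply/sym_laurent_degP.
  exact: laurent_degM da db.
Qed.
End SymmetricLaurent.

(** * Transport of graded module structures along an isomorphism *)

Section GradedTransport.
Context (k : fieldType) (A : comAlgType k) (degA : int -> A -> Prop).
Context (V W : lmodType k) (actV : A -> V -> V) (actW : A -> W -> W).
Context (degV : int -> V -> Prop) (degW : int -> W -> Prop).
Context (Theta : {linear V -> W}).

Lemma graded_module_regular :
  graded_algebra degA -> graded_module degA ( *%R : A -> A -> A) degA.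
Proof.
case=> gA dA1 dAM; split=> //; split=> [v c a b|a c u v|v|a b v].
- by rewrite mulrDl scalerAl.
- by rewrite mulrDr scalerAr.
- exact: mul1r.
- by rewrite mulrA.
Qed.

(** The injective map [Theta] reflects each axiom from [W] to [V], and homogeneous components are
    pulled back along its inverse. This supplies the unit and associativity laws, which
    [layer_action] does not state. *)
Lemma graded_module_transport :
  graded_module_iso actV degV actW degW Theta ->
  graded_module degA actW degW -> graded_module degA actV degV.
Proof.
case=> bijT actT degT [[Ll Lr act1 actM] [gD gE gI] gact].
have injT := bij_inj bijT; have [G TK GK] := bijT.
have TD c u v : Theta (c *: u + v) = c *: Theta u + Theta v by exact: linearP.
split; first split.
- by move=> v c a b; apply: injT; rewrite TD !actT Ll.
- by move=> a c u v; apply: injT; rewrite TD !actT TD Lr.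
- by move=> v; apply: injT; rewrite actT act1.
- by move=> a b v; apply: injT; rewrite !actT actM.
- split=> [d|v|D c uD cd c0 d dD].
  + have [d0 dD] := gD d; split=> [|c u v /degT du /degT dv]; apply/degT.
      by rewrite linear0.
    by rewrite TD; apply: dD.
  + have [D [c [cd vE]]] := gE (Theta v).
    exists D, (G \o c); split=> [d|]; first by apply/degT; rewrite /= GK.
    apply: injT; rewrite vE linear_sum; apply: eq_bigr => d _ /=.
    by rewrite GK.
  + apply: injT; rewrite linear0; apply: (gI D (Theta \o c)) => // [e|].
      exact/degT.
    by rewrite -linear_sum c0 linear0.
- by move=> d e a v da /degT dv; apply/degT; rewrite actT; apply: gact.
Qed.
End GradedTransport.

(** * The inverse of Theta and the comparison of actions *)

Section LayerIsomorphism.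
Context (k : fieldType) (k_char0 : [pchar k] =i pred0) (n : nat).

Definition sym_to_layer (p : sym_laurent k n) : layer k n :=
  linext (@f_prod k n) (laurent_of p).

Lemma sym_to_layer_linear : linear sym_to_layer.
Proof. by move=> c p q; apply: linearP. Qed.

(** The f(j) commute, so all n! summands have the same image and their mean is that image. *)
Lemma sym_to_layer_msym chi : sym_to_layer (msym k chi) = f_prod k chi.
Proof.
pose L : {linear laurent k n -> layer k n} := linext (@f_prod k n).
rewrite /sym_to_layer msym_lperm -/L; apply: etrans (linearZZ L _ _) _.
apply: etrans _ (mean_const k_char0 n _); congr (_ *: _).
apply: etrans (linear_sum L _ _ _) _; apply: eq_bigr => s _.
rewrite lpermU; apply: etrans (linextU _ _) _; exact: f_prod_perm.
Qed.

Section Theta.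
Context (Theta : {linear layer k n -> sym_laurent k n}).
Hypothesis Theta_f : forall chi, Theta (f_prod k chi) = msym k chi.

Lemma Theta_sym p : Theta (sym_to_layer p) = p.
Proof.
move: p; apply: sym_laurent_ind => // [c p q Ep Eq||chi].
- by rewrite sym_to_layer_linear linearP Ep Eq.
- by rewrite (linear_fun0 sym_to_layer_linear) linear0.
- by rewrite sym_to_layer_msym Theta_f.
Qed.

Lemma sym_Theta v : sym_to_layer (Theta v) = v.
Proof.
move: v; apply: layer_ind => // [c u v Eu Ev||chi].
- by rewrite linearP sym_to_layer_linear Eu Ev.
- by rewrite linear0 (linear_fun0 sym_to_layer_linear).
- by rewrite Theta_f sym_to_layer_msym.
Qed.

Lemma Theta_bij : bijective Theta.
Proof. exact: Bijective sym_Theta Theta_sym. Qed.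

Lemma Theta_deg d v : layer_deg d v <-> sym_laurent_deg d (Theta v).
Proof.
split=> [[s [/allP sd ->]]|dv].
  rewrite linear_sum big_seq; apply: (big_ind (@sym_laurent_deg k n d)).
  - exact: sym_laurent_deg0.
  - by move=> p q dp dq; rewrite -[p]scale1r; apply: sym_laurent_degD.
  - move=> a /sd /eqP <-; rewrite linearZZ Theta_f -[_ *: _]addr0.
    by apply: sym_laurent_degD;
      [exact: sym_laurent_deg_msym|exact: sym_laurent_deg0].
(* Applying the inverse to [Theta v] writes [v] with exponents from the support of [p], all of
   degree [d]. *)
set p := laurent_of (Theta v).
exists [seq (p@_chi, chi) | chi <- msupp p]; split.
  by apply/allP => _ /mapP[chi chip ->] /=; apply/eqP/dv.
by rewrite big_map -[LHS]sym_Theta.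
Qed.

(** Multiplication is carried over to the layer through [Theta]; on spanning vectors the required
    formula is [msymM]. *)
Lemma layer_action_transport :
  layer_action (fun a v => sym_to_layer (a * Theta v)).
Proof.
split=> [v c a b|a c u v|gamma chi].
- by rewrite mulrDl -scalerAl sym_to_layer_linear.
- by rewrite linearP mulrDr -scalerAr sym_to_layer_linear.
rewrite Theta_f msymM (linear_funZ sym_to_layer_linear); congr (_ *: _).
rewrite (big_morph _ (linear_funD sym_to_layer_linear)
  (linear_fun0 sym_to_layer_linear)).
by apply: eq_bigr => s _; rewrite sym_to_layer_msym.
Qed.

(** The m(gamma) span the algebra and the f(chi) u_0 span the layer, so a bilinear action is
    determined by its values on them. Every such action is therefore the transported one, which
    [Theta] intertwines by construction. *)
Lemma layer_action_uniq
    (act1 act2 : sym_laurent k n -> layer k n -> layer k n) :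
  layer_action act1 -> layer_action act2 -> act1 =2 act2.
Proof.
case=> [Ll1 Lr1 E1] [Ll2 Lr2 E2] a v; move: a.
apply: sym_laurent_ind => // [c p q Ep Eq||gamma].
- by rewrite Ll1 Ll2 Ep Eq.
- by rewrite (linear_fun0 (Ll1 v)) (linear_fun0 (Ll2 v)).
move: v; apply: layer_ind => // [c u v Eu Ev||chi].
- by rewrite Lr1 Lr2 Eu Ev.
- by rewrite (linear_fun0 (Lr1 _)) (linear_fun0 (Lr2 _)).
- by rewrite E1 E2.
Qed.

Lemma Theta_iso act : layer_action act ->
  graded_module_iso act (@layer_deg k n) *%R (@sym_laurent_deg k n) Theta.
Proof.
move=> actP; split; [exact: Theta_bij | | exact: Theta_deg].
move=> a v; rewrite (layer_action_uniq actP layer_action_transport).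
exact: Theta_sym.
Qed.
End Theta.
End LayerIsomorphism.

Theorem theorem16 (k : fieldType) (k_char0 : [pchar k] =i pred0)
    (n : nat) (n_gt0 : (0 < n)%N) :
  [/\ exists act : sym_laurent k n -> layer k n -> layer k n,
        layer_action act,
      exists Theta : {linear layer k n -> sym_laurent k n},
        forall chi : expo n, Theta (f_prod k chi) = msym k chi
    & forall (act : sym_laurent k n -> layer k n -> layer k n)
             (Theta : {linear layer k n -> sym_laurent k n}),
        layer_action act ->
        (forall chi : expo n, Theta (f_prod k chi) = msym k chi) ->
        [/\ graded_algebra (@sym_laurent_deg k n),
            graded_module (@sym_laurent_deg k n) act (@layer_deg k n),
            graded_module (@sym_laurent_deg k n) *%R (@sym_laurent_deg k n)
          & graded_module_iso act (@layer_deg k n) *%R (@sym_laurent_deg k n)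
              Theta]].
Proof.
have [Theta0 Theta0_f] := layer_to_sym_exists k n.
split.
- by exists (fun a v => sym_to_layer (a * Theta0 v));
  apply: layer_action_transport.
- by exists Theta0.
move=> act Theta actP Theta_f.
have gA := sym_laurent_graded_algebra k_char0 n.
have iso := Theta_iso k_char0 Theta_f actP.
have gR := graded_module_regular gA.
split; [exact: gA | exact: graded_module_transport iso gR | exact: gR |].
exact: iso.
Qed.
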